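(* There exist absolute constants $c_1,c_2,c_3>0$ such that the following holds. Let $\varepsilon\in(0,\frac12)$. For any sufficiently large $k$ (depending on $\varepsilon$) there exists a matrix $B\in\mathbb R^{n\times n}$, $n=2^k$, such that: (i) in each row, $B$ differs from $H^k$ in at most $n^{c_1\varepsilon\log(1/\varepsilon)}$ entries; (ii) $\operatorname{rank}B\le n^{1-c_2\varepsilon^2}$; (iii) $\|B\|_\infty\le n^{\frac12+c_3\varepsilon\log(1/\varepsilon)}$.
   Context: $H^k\in\{-1,1\}^{n\times n}$, $n=2^k$, is the Walsh--Hadamard matrix: its rows and columns are indexed by boolean vectors $x,y\in\{0,1\}^k$ and $H^k_{x,y}=(-1)^{\sum_{i=1}^kx_iy_i}$. For a matrix $B$, $\|B\|_\infty:=\max_{i,j}|B_{i,j}|$ is the element-wise maximum norm. The rank is over $\mathbb R$. *)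

(* Defs.v *)
From mathcomp Require Import all_boot all_order all_algebra.
From mathcomp Require Import all_classical all_reals all_analysis.

Set Implicit Arguments.
Unset Strict Implicit.
Unset Printing Implicit Defensive.

Import Order.TTheory GRing.Theory Num.Theory.
Import numFieldNormedType.Exports.

Local Open Scope ring_scope.

(* The index x < 2 ^ k stands for the boolean vector of its k binary digits;
   boolvec_bij: this is a bijection onto {0,1}^k. *)
Definition boolvec (k : nat) (x : 'I_(2 ^ k)) : {ffun 'I_k -> bool} :=
  [ffun i : 'I_k => odd (x %/ 2 ^ i)].

Lemma boolvec_bij (k : nat) : bijective (@boolvec k).
Proof.
apply: inj_card_bij; last by rewrite card_ffun card_bool !card_ord.
move=> x y /ffunP exy; apply: val_inj => /=.
have {exy}: forall i, (i < k)%N -> odd (x %/ 2 ^ i) = odd (y %/ 2 ^ i).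
  by move=> i ik; have := exy (Ordinal ik); rewrite !ffunE.
move: (ltn_ord x) (ltn_ord y); move: (nat_of_ord x) (nat_of_ord y) => {x y}.
elim: k => [|k IH] x y; first by rewrite expn0 !ltnS !leqn0 => /eqP-> /eqP->.
move=> xk yk exy; rewrite -(odd_double_half x) -(odd_double_half y).
have := exy 0 isT; rewrite expn0 !divn1 => ->; congr (_ + _.*2)%N.
apply: IH => [||i ik].
- by rewrite -divn2 ltn_divLR // -expnSr.
- by rewrite -divn2 ltn_divLR // -expnSr.
- by have := exy i.+1 ik; rewrite expnS !divnMA !divn2.
Qed.

Definition walsh_hadamard (R : realType) (k : nat) : 'M[R]_(2 ^ k) :=
  \matrix_(x, y) (-1) ^+ (\sum_(i < k) boolvec x i * boolvec y i)%N.

(* Main.v *)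
Require Import Defs.
From mathcomp Require Import all_boot all_order all_algebra.
From mathcomp Require Import all_classical all_reals all_analysis.
From mathcomp Require Import ring lra zify.

Set Implicit Arguments.
Unset Strict Implicit.
Unset Printing Implicit Defensive.

Import Order.TTheory GRing.Theory Num.Theory.
Import numFieldNormedType.Exports.

Local Open Scope ring_scope.

(** Identify an index with the set A of ones of its boolean vector. Since
#|A| = #|A :&: C| + #|A :\: C|, the Walsh-Hadamard entry at sets A, C is
(-1)^#|A| * (-1)^w with w = #|A :\: C|. The sign (-1)^w = (1 - 2)^w is the
binomial sum over all i of (-2)^i 'C(w, i), and cutting the sum at i <= e
changes nothing as long as w <= e ([truncated_sign_exact]). The cut sum is of
low rank, because 'C(w, i) counts the i-subsets of A that avoid C: it is a sum
of rank-one terms indexed by the sets of size at most e.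

Take m about eps * k and e = k./2 - m. Rows with #|~: A| <= e and columns with
#|C| <= e are kept exact; there are few of them, so this costs little rank
([walsh_approx_rank]). On the other rows and columns:
- an error needs w > e; as #|~: A| > e and #|C| > e as well, C must then be
  within Hamming distance 4 m of the complement of A, so that errors are
  counted by a Hamming ball of radius 4 m ([walsh_approx_errors]);
- the cut sum is at most 1 + 2^(e+1) 'C(w, e+1), although its individual terms
  can be far larger ([truncated_sign_bound]); since w <= e + 2 m, the binomial
  is again dominated by the ball of radius 4 m, and 2^(e+1) <= 2^(k/2)
  ([walsh_approx_norm]).

Finally, a ball of radius 4 m has at most 2^(O(eps log(1/eps)) k) points
([ball_card_entropy]), and one of radius k/2 - m at most 2^k exp(-eps^2 k/8)
points ([ball_card_chernoff]). Both estimates come from the same Markov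
inequality applied to t^#|S| ([ball_card_markov]). *)

(** * Truncated binomial expansion of a sign *)

Definition truncated_sign (R : pzRingType) (d w : nat) : R :=
  \sum_(i < d) (- 2) ^+ i * 'C(w, i)%:R.

Lemma truncated_sign_exact (R : comPzRingType) (d w : nat) :
  (w < d)%N -> truncated_sign R d w = (-1) ^+ w.
Proof.
move=> wd; have -> : -1 = 1 + (- 2) :> R by ring.
rewrite exprDn /truncated_sign.
rewrite (big_ord_widen _ (fun i => (1 : R) ^+ (w - i) * (- 2) ^+ i *+ 'C(w, i)) wd).
rewrite [LHS](bigID (fun i : 'I_d => (i < w.+1)%N)) /= [X in _ + X]big1 ?addr0.
  by apply: eq_bigr => i _; rewrite expr1n mul1r mulr_natr.
by move=> i; rewrite -leqNgt => wi; rewrite bin_small // mulr0.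
Qed.

(** Pascal's rule gives the value at w+1 from the values at w for the two cut-offs
d and d+1, which differ by one term; what remains is the sign flip of an exact
sign, with a single binomial as defect. *)
Lemma truncated_signS (R : comPzRingType) (d w : nat) :
  truncated_sign R d.+1 w.+1
  = - truncated_sign R d.+1 w - (- 2) ^+ d.+1 * 'C(w, d)%:R.
Proof.
elim: d => [|d IH].
  by rewrite /truncated_sign !big_ord_recr !big_ord0 /= !bin0; ring.
rewrite /truncated_sign 2![\sum_(i < d.+2) _]big_ord_recr /=.
move: IH; rewrite /truncated_sign => ->; rewrite binS natrD !exprS; ring.
Qed.

(** Each step of the recurrence adds at most 2^(d+1) 'C(w, d) to the absolute
value, and these binomials sum to 'C(w, d+1). Bounding the alternating sum term
by term would lose an exponential factor. *)
Lemma truncated_sign_bound (R : realDomainType) (d w : nat) :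
  `|truncated_sign R d.+1 w| <= 1 + 2 ^+ d.+1 * 'C(w, d.+1)%:R.
Proof.
elim: w => [|w IH].
  by rewrite truncated_sign_exact // bin0n mulr0 expr0 normr1 addr0.
rewrite truncated_signS; apply: le_trans (ler_normB _ _) _.
rewrite normrN normrM normrX normrN !normr_nat binS natrD mulrDr addrA.
by rewrite lerD2r.
Qed.

(** * Boolean vectors as sets *)

Definition supp (k : nat) (x : 'I_(2 ^ k)) : {set 'I_k} :=
  [set i | boolvec x i]%SET.

Lemma supp_bij (k : nat) : bijective (@supp k).
Proof.
apply: inj_card_bij; last first.
  by rewrite -[#|{set _}|]cardsT -powersetT card_powerset cardsT !card_ord.
move=> x y /setP exy; apply: (bij_inj (@boolvec_bij k)).
by apply/ffunP => i; have := exy i; rewrite !inE.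
Qed.

Lemma card_supp (k : nat) (P : pred {set 'I_k}) :
  #|[set x | P (supp x)]%SET| = #|[set S | P S]%SET|.
Proof.
rewrite -(on_card_preimset (onW_bij _ (@supp_bij k))).
by apply: eq_card => x; rewrite !inE.
Qed.

(** Using the difference instead of the intersection puts the frequent values
of the exponent at the low end, where the truncated expansion is exact. *)
Lemma walsh_hadamardE (R : realType) (k : nat) (x y : 'I_(2 ^ k)) :
  walsh_hadamard R k x y = (-1) ^+ #|supp x| * (-1) ^+ #|supp x :\: supp y|.
Proof.
rewrite mxE -exprD -(cardsID (supp y) (supp x)) -addnA addnn.
rewrite exprD -mul2n exprM sqrrN !expr1n mulr1; congr (_ ^+ _).
rewrite -sum1_card [RHS]big_mkcond /=; apply: eq_bigr => i _.
by rewrite !inE; do 2!case: (boolvec _ i).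
Qed.

(** * Size of Hamming balls *)

Definition ball_card (k r : nat) : nat := #|[set S : {set 'I_k} | (#|S| <= r)%N]%SET|.

(** The generating function of the sizes of all subsets is (1 + t)^k, and each
set of the ball contributes at least t^r to it. *)
Lemma ball_card_markov (R : realFieldType) (k r : nat) (t : R) :
  0 < t -> t <= 1 -> (ball_card k r)%:R * t ^+ r <= (1 + t) ^+ k.
Proof.
move=> t0 t1.
have -> : (1 + t) ^+ k = \sum_(S : {set 'I_k}) t ^+ #|S|.
  rewrite -[k in LHS]card_ord -prodr_const addrC bigA_distr.
  by apply: eq_bigr => S _; rewrite -big_mkcond /= prodr_const.
rewrite /ball_card mulr_natl -sumr_const.
rewrite [leRHS](bigID (mem [set S : {set 'I_k} | (#|S| <= r)%N]%SET)) /=.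
rewrite -[leLHS]addr0 lerD //; last first.
  by apply: sumr_ge0 => S _; rewrite exprn_ge0 // ltW.
by apply: ler_sum => S; rewrite inE => Sr; rewrite ler_wiXn2l // ltW.
Qed.

Lemma bin_lt_ball_card (k i r : nat) :
  (0 < i <= r)%N -> ('C(k, i) < ball_card k r)%N.
Proof.
move=> /andP[i0 ir]; rewrite -[k in 'C(k, _)]card_ord -card_draws.
apply/proper_card/properP; split.
  by apply/fintype.subsetP => S; rewrite !inE => /eqP ->.
by exists finset.set0; rewrite !inE cards0 // eq_sym -?lt0n -?leqNgt ?lt0n_neq0.
Qed.

(** Both exponentials are at most geometric sums, exp(v) <= 1/(1 - v), and
1/(1 - u) + 1/(1 + u) = 2/(1 - u^2). *)
Lemma expR_cosh_le (R : realType) (u : R) :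
  0 <= u -> u <= 1 / 2 -> expR u + expR (- u) <= 2 * expR (2 * u ^+ 2).
Proof.
move=> u0 u1.
have inv_le (v : R) : 0 < 1 - v -> expR v <= (1 - v)^-1.
  by move=> v1; rewrite -[v in expR v]opprK expRN lef_pV2 ?posrE ?expR_gt0 //;
     apply: expR_ge1Dx.
have um : 0 < 1 - u by lra.
have up : 0 < 1 - - u by lra.
apply: le_trans (lerD (inv_le _ um) (inv_le _ up)) _.
apply: (@le_trans _ _ (2 * (1 + 2 * u ^+ 2))); last first.
  by rewrite ler_pM2l //; apply: expR_ge1Dx.
have -> : (1 - u)^-1 + (1 - - u)^-1 = 2 / ((1 - u) * (1 + u)).
  by field; apply/andP; split; lra.
rewrite ler_pdivrMr; last by rewrite mulr_gt0; lra.
have : 0 <= u ^+ 2 * (1 - 2 * u ^+ 2) by apply: mulr_ge0; nra.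
by lra.
Qed.

(** Markov's inequality with t = exp(- d), the right order of magnitude for d
being m / k. *)
Lemma ball_card_chernoff (R : realType) (k e m : nat) (d : R) :
  0 <= d -> d <= 1 -> d * k%:R <= m%:R -> (2 * (e + m) <= k)%N ->
  (ball_card k e)%:R <= 2 ^+ k * expR (- (d ^+ 2 / 2 * k%:R)).
Proof.
move=> d0 d1 dk emk.
have t1 : expR (- d) <= 1 by rewrite -expR0 ler_expR; lra.
have := ball_card_markov k e (expR_gt0 (- d)) t1.
rewrite -expRM_natr -ler_pdivlMr ?expR_gt0 // -expRN => /le_trans; apply.
have -> : 1 + expR (- d) = expR (- (d / 2)) * (expR (d / 2) + expR (- (d / 2))).
  by rewrite mulrDr -!expRD addNr expR0; congr (_ + expR _); lra.
have ch : expR (d / 2) + expR (- (d / 2)) <= 2 * expR (2 * (d / 2) ^+ 2).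
  by apply: expR_cosh_le; lra.
apply: (@le_trans _ _ ((expR (- (d / 2)) * (2 * expR (2 * (d / 2) ^+ 2))) ^+ k
                        * expR (- (- d * e%:R)))).
  rewrite ler_pM2r ?expR_gt0 // lerXn2r ?nnegrE ?mulr_ge0 ?addr_ge0 ?expR_ge0 //.
  by rewrite ler_pM2l ?expR_gt0.
have -> (a b c : R) : (a * (2 * b)) ^+ k * c = 2 ^+ k * ((a * b) ^+ k * c).
  by rewrite mulrCA exprMn mulrA.
rewrite ler_pM2l ?exprn_gt0 // -expRD -expRM_natr -expRD ler_expR.
have ekm : 2 * (e%:R + m%:R) <= k%:R :> R by rewrite -natrD -natrM ler_nat.
have := ler_wpM2l d0 ekm; have := ler_wpM2l d0 dk; nra.
Qed.

(** Markov's inequality with t = eps; the radius of interest is r = O(eps k). *)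
Lemma ball_card_entropy (R : realType) (k r : nat) (eps : R) :
  0 < eps -> eps <= 1 ->
  (ball_card k r)%:R <= expR (r%:R * ln (1 / eps) + eps * k%:R).
Proof.
move=> e0 e1; have := ball_card_markov k r e0 e1.
rewrite -ler_pdivlMr ?exprn_gt0 // => /le_trans; apply.
rewrite expRD expRM_natl lnK ?posrE ?divr_gt0 // div1r exprVn mulrC.
rewrite ler_pM2l ?invr_gt0 ?exprn_gt0 // expRM_natr lerXn2r ?nnegrE ?expR_ge0 //.
  by rewrite addr_ge0 // ltW.
exact: expR_ge1Dx.
Qed.

(** * The approximating matrix *)

Lemma mxrank_le_card (F : fieldType) (m n : nat) (I : finType) (A : {pred I})
    (f : I -> 'I_m -> F) (g : I -> 'I_n -> F) (M : 'M[F]_(m, n)) :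
  (forall x y, M x y = \sum_(s in A) f s x * g s y) -> (\rank M <= #|A|)%N.
Proof.
move=> ME.
have -> : M = \sum_(s in A) (\col_x f s x) *m (\row_y g s y).
  apply/matrixP => x y; rewrite ME summxE; apply: eq_bigr => s _.
  by rewrite !mxE big_ord1 !mxE.
rewrite -sum1_card; elim/big_rec2: _ => [|s r N _ IH]; first by rewrite mxrank0.
apply: leq_trans (mxrank_add _ _) (leq_add _ IH).
exact: leq_trans (mxrankM_maxr _ _) (rank_leq_row _).
Qed.

(** The subset form exhibits the rank: [S \subset A] with A the difference of two
sets is a product of a condition on the first and one on the second. *)
Lemma truncated_sign_subsets (R : comPzRingType) (k e : nat) (A : {set 'I_k}) :
  truncated_sign R e.+1 #|A| =
  \sum_(S in [set S : {set 'I_k} | (#|S| <= e)%N]%SET)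
     (- 2) ^+ #|S| * (S \subset A)%:R.
Proof.
rewrite (partition_big (fun S : {set 'I_k} => inord #|S| : 'I_e.+1) xpredT) //=.
apply: eq_bigr => i _.
transitivity (\sum_(S in [set S : {set 'I_k} | (#|S| <= e)%N]%SET
                  | inord #|S| == i) (- 2 : R) ^+ i * (S \subset A)%:R); last first.
  apply: eq_bigr => S /andP[]; rewrite inE => Se /eqP <-.
  by rewrite inordK.
rewrite -big_distrr /= -cards_draws -sum1_card natr_sum; congr (_ * _).
rewrite big_mkcond [RHS]big_mkcond /=; apply: eq_bigr => S _; rewrite !inE.
case: (leqP #|S| e) => /= Se; last first.
  case: eqP => [Si|]; last by rewrite andbF.
  by have := ltn_ord i; rewrite -Si ltnS leqNgt Se.
by rewrite -val_eqE /= inordK //; case: (_ == _); case: (_ \subset _).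
Qed.

Definition walsh_approx (R : realType) (k e : nat) : 'M[R]_(2 ^ k) :=
  \matrix_(x, y)
    if (#|~: supp x| <= e)%N || (#|supp y| <= e)%N then walsh_hadamard R k x y
    else (-1) ^+ #|supp x| * truncated_sign R e.+1 #|supp x :\: supp y|.

(** One ball for the subset expansion, one for the exact rows and one for the
exact columns. *)
Lemma walsh_approx_rank (R : realType) (k e : nat) :
  (\rank (walsh_approx R k e) <= 3 * ball_card k e)%N.
Proof.
pose heavy (x : 'I_(2 ^ k)) := (#|~: supp x| <= e)%N.
pose light (y : 'I_(2 ^ k)) := (#|supp y| <= e)%N.
pose P : 'M[R]_(2 ^ k) := \matrix_(x, y)
  ((-1) ^+ #|supp x| * truncated_sign R e.+1 #|supp x :\: supp y|).
pose E := walsh_hadamard R k - P.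
pose E1 : 'M[R]_(2 ^ k) := \matrix_(x, y) ((heavy x)%:R * E x y).
pose E2 : 'M[R]_(2 ^ k) := \matrix_(x, y) ((~~ heavy x && light y)%:R * E x y).
have -> : walsh_approx R k e = P + E1 + E2.
  apply/matrixP => x y; rewrite !mxE /= -/(heavy x) -/(light y).
  by case: (heavy x); case: (light y) => /=; ring.
have cardC : #|[set S : {set 'I_k} | (#|~: S| <= e)%N]%SET| = ball_card k e.
  rewrite -(card_imset _ (can_inj (@finset.setCK _))); apply: eq_card => S.
  rewrite -[S in LHS]finset.setCK (mem_imset _ _ (can_inj (@finset.setCK _))).
  by rewrite !inE finset.setCK.
rewrite mulSn mulSn mul1n addnA.
apply: leq_trans (mxrank_add _ _) (leq_add _ _).
  apply: leq_trans (mxrank_add _ _) (leq_add _ _).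
    apply: (@mxrank_le_card R _ _ {set 'I_k}
      (mem [set S : {set 'I_k} | (#|S| <= e)%N]%SET)
      (fun S x => (-1) ^+ #|supp x| * (- 2) ^+ #|S| * (S \subset supp x)%:R)
      (fun S y => [disjoint S & supp y]%:R)) => x y.
    rewrite mxE truncated_sign_subsets mulr_sumr; apply: eq_bigr => S _.
    by rewrite finset.subsetD -mulnb natrM !mulrA.
  rewrite -cardC -card_supp.
  apply: (@mxrank_le_card _ _ _ _ _ (fun z x => (x == z)%:R) (fun z y => E z y)).
  move=> x y; rewrite mxE big_mkcond (bigD1 x) //= big1 ?addr0; last first.
    by move=> z /negbTE zx; rewrite eq_sym zx mul0r if_same.
  by rewrite inE eqxx -/(heavy x); case: (heavy x); rewrite ?mul1r ?mul0r.
rewrite /ball_card -(card_supp (fun S => (#|S| <= e)%N)).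
apply: (@mxrank_le_card _ _ _ _ _
  (fun z x => (~~ heavy x)%:R * E x z) (fun z y => (y == z)%:R)).
move=> x y; rewrite mxE big_mkcond (bigD1 y) //= big1 ?addr0; last first.
  by move=> z /negbTE zy; rewrite eq_sym zy mulr0 if_same.
by rewrite inE eqxx -/(light y); case: (light y); rewrite ?andbT ?andbF ?mulr1 ?mul0r.
Qed.

(** With A and C the supports of the row and the column, an error forces
#|A :&: C| and #|~: (A :|: C)| to be both at most 2 m: this is where the
exactness of dense rows and of sparse columns enters. The union of these two
sets determines C, being its symmetric difference with ~: A. *)
Lemma walsh_approx_errors (R : realType) (k e m : nat) (x : 'I_(2 ^ k)) :
  (k <= 2 * (e + m) + 1)%N ->
  (#|[set y | walsh_approx R k e x y != walsh_hadamard R k x y]%SET|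
     <= ball_card k (4 * m))%N.
Proof.
move=> kem; pose A := supp x.
(* phi S is the symmetric difference of S and ~: A. *)
pose phi (S : {set 'I_k}) := [set i | (i \in S) == (i \in A)]%SET.
have phiK : involutive phi.
  by move=> S; apply/setP => i; rewrite !inE; case: (i \in S); case: (boolvec x i).
rewrite -(card_imset _ (inj_comp (can_inj phiK) (bij_inj (@supp_bij k)))).
apply: subset_leq_card; apply/fintype.subsetP => _ /imsetP[y + ->].
rewrite inE mxE; case: ifP => [_|/negbT]; first by rewrite eqxx.
rewrite negb_or -!ltnNge inE /= => /andP[xe ye].
have [we|we _] := ltnP #|supp x :\: supp y| e.+1.
  by rewrite truncated_sign_exact // walsh_hadamardE eqxx.
have -> : phi (supp y) = (A :&: supp y) :|: ~: (A :|: supp y).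
  by apply/setP => i; rewrite !inE; case: (boolvec x i); case: (boolvec y i).
apply: leq_trans (leq_card_setU _ _) _.
have kE := cardsC A; have k2E := cardsC (A :|: supp y).
have iE := cardsUI A (supp y); have dE := cardsID (supp y) A.
rewrite card_ord in kE k2E; rewrite -/A in we.
have {}xe : (#|A| + e < k)%N by have := xe; rewrite -(ltn_add2l #|A|) kE.
have {}ye : (#|A| + e < #|A :|: supp y| + #|A :&: supp y|)%N.
  by rewrite iE ltn_add2l.
lia.
Qed.

(** Outside the exact rows w <= e + 2 m, and by symmetry 'C(e + 2 m, e + 1) is a
number of (2 m - 1)-subsets, hence less than the size of the ball. *)
Lemma walsh_approx_norm (R : realType) (k e m : nat) :
  (0 < m)%N -> (2 * (e + m) <= k <= 2 * (e + m) + 1)%N ->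
  mx_norm (walsh_approx R k e) <= (2 ^ (e + m) * ball_card k (4 * m))%:R.
Proof.
move=> m0 /andP[emk kem]; rewrite mx_normrE; apply: bigmax_le => [|[x y] _ /=].
  exact: ler0n.
have Clt : ('C(k, (2 * m).-1) < ball_card k (4 * m))%N.
  by apply: bin_lt_ball_card; lia.
have p2 : (0 < 2 ^ (e + m))%N by rewrite expn_gt0.
rewrite mxE; case: ifP => [_|/negbT].
  rewrite walsh_hadamardE normrM !normrX normrN1 !expr1n mulr1 ler1n muln_gt0.
  by rewrite p2 (leq_ltn_trans _ Clt).
rewrite negb_or -!ltnNge => /andP[xe _].
rewrite normrM normrX normrN1 expr1n mul1r.
apply: le_trans (truncated_sign_bound _ _ _) _.
rewrite -natrX -natrM -(natrD _ 1%N) ler_nat.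
set w := #|_ :\: _|.
have wle : (w <= e + 2 * m)%N.
  have := cardsC (supp x); have := cardsID (supp y) (supp x).
  by rewrite card_ord -/w => ? ?; lia.
have Cw : ('C(w, e.+1) <= 'C(k, (2 * m).-1))%N.
  apply: leq_trans (leq_bin2l _ wle) _.
  rewrite -bin_sub; last lia.
  by rewrite (_ : e + 2 * m - e.+1 = (2 * m).-1)%N; [apply: leq_bin2l; lia | lia].
apply: (@leq_trans (2 ^ e.+1 * ball_card k (4 * m))%N); last first.
  by rewrite leq_mul2r leq_pexp2l ?orbT //; lia.
have : (0 < 2 ^ e.+1)%N by rewrite expn_gt0.
move: (2 ^ e.+1)%N => q q0.
apply: (@leq_trans (q * 'C(w, e.+1).+1)%N); first by rewrite mulnS leq_add2r.
by rewrite leq_mul2l (leq_ltn_trans Cw Clt) orbT.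
Qed.

(** * Asymptotics *)

Lemma ln2_bounds (R : realType) : 1 / 2 <= ln (2 : R) <= 1.
Proof.
have h : -1 < - (1 / 2) :> R by lra.
have h1 : -1 < 1 :> R by lra.
have := le_ln1Dx h; have := le_ln1Dx h1.
rewrite (_ : 1 + - (1 / 2) = 2^-1 :> R); last by lra.
by rewrite lnV ?posrE // => ? ?; apply/andP; split; lra.
Qed.

Lemma exp2_expR (R : realType) (k : nat) : (2 : R) ^+ k = expR (k%:R * ln 2).
Proof. by rewrite expRM_natl lnK ?posrE. Qed.

Lemma pow2_powR (R : realType) (k : nat) (s : R) :
  (2 ^ k)%:R `^ s = expR (s * (k%:R * ln 2)).
Proof. by rewrite /powR pnatr_eq0 expn_eq0 /= natrX lnXn ?mulr_natl. Qed.

Theorem mainTheorem4 (R : realType) :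
  exists c1 c2 c3 : R, [/\ 0 < c1, 0 < c2, 0 < c3 &
    forall eps : R, 0 < eps -> eps < 1 / 2 ->
    exists k0 : nat, forall k : nat, (k0 <= k)%N ->
    let n : R := (2 ^ k)%:R in
    exists B : 'M[R]_(2 ^ k),
      [/\ forall x : 'I_(2 ^ k),
            #|[set y | B x y != walsh_hadamard R k x y]|%:R
              <= n `^ (c1 * eps * ln (1 / eps)),
          (\rank B)%:R <= n `^ (1 - c2 * eps ^+ 2) &
          mx_norm B <= n `^ (1 / 2 + c3 * eps * ln (1 / eps))]].
Proof.
exists 12, (1 / 16), 12; split; [lra..|] => eps eps0 eps1.
(* k >= 32 / eps ^ 2 gives m > 0 and absorbs the factor 3 in the rank. *)
exists (Num.truncn (32 / eps ^+ 2)).+1 => k k0k n.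
have [l2 l2'] := andP (ln2_bounds R).
have eps2 : 0 < eps ^+ 2 by rewrite exprn_gt0.
have kE : 32 <= eps ^+ 2 * k%:R.
  rewrite mulrC -ler_pdivrMr //; apply: ltW.
  by apply: lt_le_trans (truncnS_gt _) _; rewrite ler_nat.
have kpos : 0 <= k%:R :> R by [].
have ek : 32 <= eps * k%:R by nra.
have L : 1 / 2 <= ln (1 / eps).
  rewrite [1 / eps]div1r lnV ?posrE //.
  have : ln (1 + (eps - 1)) <= eps - 1 by apply: le_ln1Dx; lra.
  by rewrite addrC subrK; lra.
pose m := Num.truncn (eps * k%:R); pose e := (k./2 - m)%N.
have [mle mgt] : m%:R <= eps * k%:R /\ eps * k%:R < m%:R + 1.
  have := @truncn_itv _ (eps * k%:R); rewrite -/m natr1 => /(_ _) /andP[|h1 h2].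
    by lra.
  by split.
have m0 : (0 < m)%N by rewrite -(ltr_nat R); lra.
have mk : (2 * m <= k)%N by rewrite -(ler_nat R) natrM; nra.
have [emk kem] : (2 * (e + m) <= k)%N /\ (k <= 2 * (e + m) + 1)%N by lia.
have V : (ball_card k (4 * m))%:R <= n `^ (12 * eps * ln (1 / eps)).
  apply: le_trans (ball_card_entropy _ _ eps0 _) _; first by lra.
  rewrite pow2_powR ler_expR natrM.
  move: (ln _) L => l L.
  have h1 : 0 <= (eps * k%:R - m%:R) * l by apply: mulr_ge0; lra.
  have h2 : 0 <= (eps * k%:R) * (l - 1 / 2) by apply: mulr_ge0; lra.
  have h3 : 0 <= (eps * k%:R * l) * (ln 2 - 1 / 2).
    by apply: mulr_ge0; first apply: mulr_ge0; lra.
  by lra.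
exists (walsh_approx R k e); split.
- by move=> x; apply: le_trans V; rewrite ler_nat walsh_approx_errors.
- apply: (@le_trans _ _ (3 * (ball_card k e)%:R)).
    by rewrite -natrM ler_nat walsh_approx_rank.
  (* eps / 2 instead of eps, because m rounds eps * k down. *)
  have T : (ball_card k e)%:R <= 2 ^+ k * expR (- ((eps / 2) ^+ 2 / 2 * k%:R)).
    by apply: (@ball_card_chernoff _ _ _ m) => //; lra.
  have three : 3 <= expR (eps ^+ 2 * k%:R / 16).
    by apply: le_trans (expR_ge1Dx _); lra.
  apply: le_trans (ler_pM _ _ three T) _; rewrite ?ler0n //.
  rewrite pow2_powR exp2_expR -!expRD ler_expR.
  have : 0 <= (eps ^+ 2 * k%:R) * (1 - ln 2) by apply: mulr_ge0; lra.
  by lra.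
- apply: le_trans (walsh_approx_norm _ m0 _) _; first by rewrite emk.
  rewrite powRD; last by apply/implyP => _; rewrite pnatr_eq0 expn_eq0.
  rewrite natrM ler_pM ?ler0n //.
  rewrite pow2_powR natrX exp2_expR ler_expR.
  have : 2 * (e + m)%:R <= k%:R :> R by rewrite -natrM ler_nat.
  by nra.
Qed.
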